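(* Let $a\in\mathbb{C}\setminus\{0\}$, $b\in\mathbb{C}$ and $C(x)=\begin{pmatrix}c_{11}(x)&c_{12}(x)\\c_{21}(x)&c_{22}(x)\end{pmatrix}\in\mathbb{C}[x]^{2\times2}$. Then $V_{a,b,C(x)}$ is irreducible if and only if $c_{21}(x)\neq0$, $c_{12}(x)\neq0$ and the equation $$\gamma'(x)+(c_{11}(x)-c_{22}(x))\gamma(x)-c_{21}(x)\gamma^2(x)+c_{12}(x)=0$$ does not have solutions $\gamma(x)$ in $\mathbb{C}(x)$.
   Context: The Virasoro conformal algebra is $Vir=\mathbb{C}[\partial]L$ with $[L_\lambda L]=(\partial+2\lambda)L$. A generalized conformal module $V$ over $Vir$ is a $\mathbb{C}[\partial]$-module with a linear map $L_\lambda:V\to V[[\lambda]]$ such that $L_\lambda(\partial v)=(\partial+\lambda)L_\lambda v$ and $L_\lambda(L_\mu v)-L_\mu(L_\lambda v)=(\lambda-\mu)L_{\lambda+\mu}v$ for all $v\in V$. A submodule is a $\mathbb{C}[\partial]$-submodule $W$ with $L_\lambda W\subseteq W[[\lambda]]$; $V$ is irreducible if $V\ne0$ and its only submodules are $0$ and $V$. For $a,b\in\mathbb{C}$ and $C(x)\in\mathbb{C}[x]^{n\times n}$ (with the variable $x$ standing for $\partial$), $V_{a,b,C(x)}$ is the free module $\mathbb{C}[x]^n$ (with $\partial$ acting as multiplication by $x$) with the action $$L_\lambda\mathbf{f}(x)=(x+a\lambda+b)e^{\lambda\mathcal{L}}\mathbf{f}(x)=\sum_{k\ge0}\frac{\lambda^k}{k!}\big((x+b)\mathcal{L}^k+ka\mathcal{L}^{k-1}\big)\mathbf{f}(x),$$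 where $\mathcal{L}=\frac{d}{dx}+C(x)$ acts on column vectors by $\mathcal{L}\mathbf{f}=\mathbf{f}'+C(x)\mathbf{f}$. This is a generalized conformal module over $Vir$. Here $n=2$, and ''$\neq0$'' for the entries of $C(x)$ means not the zero polynomial. *)

(* Defs.v *)
From HB Require Import structures.
From mathcomp Require Import all_boot all_order all_algebra.
From mathcomp Require Import fraction ring.
From mathcomp Require Import classical_sets reals.
From mathcomp Require Export complex.

Set Implicit Arguments.
Unset Strict Implicit.
Unset Printing Implicit Defensive.

Import Order.TTheory GRing.Theory Num.Theory.
Local Open Scope ring_scope.

(* {fraction _} comes without a derivation: this is the quotient rule on the
   representative chosen by [repr]; [fracderivE] shows that the choice of the
   representative is immaterial. *)
Definition fracderiv (F : fieldType) (g : {fraction {poly F}}) :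
    {fraction {poly F}} :=
  let p := \n_(repr g) in let q := \d_(repr g) in
  FracField.tofrac (p^`() * q - p * q^`()) / FracField.tofrac (q ^+ 2).

Section FracRepr.
Variable R : idomainType.
Local Notation tofrac := (@FracField.tofrac R).

Lemma frac_reprE (g : {fraction R}) :
  g = tofrac \n_(repr g) / tofrac \d_(repr g).
Proof.
rewrite -{1}(reprK g); move: (repr g) => r.
have dr : \d_r != 0 by exact: denom_ratioP.
have dr' : tofrac \d_r != 0 by rewrite tofrac_eq0.
apply: (mulIf dr'); rewrite divfK //.
unlock FracField.tofrac; rewrite -[LHS]FracField.pi_mul.
apply/eqmodP; rewrite /= FracField.equivfE /FracField.mulf.
by rewrite !numden_Ratio ?mulf_neq0 ?oner_neq0 // !mulr1 mulrC.
Qed.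

Lemma eq_tofrac_div (p q n d : R) : q != 0 -> d != 0 ->
  (tofrac p / tofrac q == tofrac n / tofrac d) = (p * d == n * q).
Proof. by move=> q0 d0; rewrite eqr_div ?tofrac_eq0 // -!tofracM tofrac_eq. Qed.

End FracRepr.

Section FracDeriv.
Variable F : fieldType.
Local Notation tofrac := (@FracField.tofrac {poly F}).

Lemma fracderivE (p q : {poly F}) : q != 0 ->
  fracderiv (tofrac p / tofrac q) =
  tofrac (p^`() * q - p * q^`()) / tofrac (q ^+ 2).
Proof.
move=> q0; rewrite /fracderiv.
have := frac_reprE (tofrac p / tofrac q).
have := denom_ratioP (repr (tofrac p / tofrac q)).
move: (\n_(repr _)) (\d_(repr _)) => n d d0 /eqP.
rewrite eq_tofrac_div // => /eqP pd.
apply/eqP; rewrite eq_tofrac_div ?expf_neq0 //; apply/eqP.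
have pd' : p^`() * d + p * d^`() = n^`() * q + n * q^`().
  by rewrite -!derivM pd.
transitivity ((n^`() * q) * (d * q) - (n * q) * (d^`() * q)); first by ring.
transitivity ((p^`() * d) * (q * d) - (p * d) * (q^`() * d)); last by ring.
have -> : n^`() * q = p^`() * d + p * d^`() - n * q^`() by rewrite pd'; ring.
rewrite -pd.
transitivity (p^`() * d * (q * d) - (n * q) * (q^`() * d)); first by ring.
by rewrite -pd; ring.
Qed.

End FracDeriv.

(* A C[d]-module is an [lmodType {poly F}], with d acting as ['X] and the scalars
   as constant polynomials.  A series in V[[lambda]] is the sequence
   [nat -> V] of its coefficients, and one in V[[lambda, mu]] is
   [nat -> nat -> V], the first index being the exponent of lambda. *)
Section FormalSeries.
Variable V : zmodType.

Definition mul_lam (s : nat -> V) : nat -> V :=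
  fun k => if k is k'.+1 then s k' else 0.

Definition mul_lam_sub_mu (s : nat -> nat -> V) : nat -> nat -> V :=
  fun i j => (if i is i'.+1 then s i' j else 0)
             - (if j is j'.+1 then s i j' else 0).

(* s(lambda + mu) *)
Definition subst_add (s : nat -> V) : nat -> nat -> V :=
  fun i j => s (i + j)%N *+ 'C(i + j, i).

End FormalSeries.

(* [vir_act v k] is the coefficient of lambda^k in L_lambda v. *)
Record virModule (F : numFieldType) := VirModule {
  vir_car :> lmodType {poly F};
  vir_act : vir_car -> nat -> vir_car;
  vir_act_linear : forall (c : F) (u v : vir_car) k,
    vir_act (c%:P *: u + v) k = c%:P *: vir_act u k + vir_act v k;
  vir_act_partial : forall (v : vir_car) k,
    vir_act ('X *: v) k = 'X *: vir_act v k + mul_lam (vir_act v) k;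
  vir_act_bracket : forall (v : vir_car) i j,
    vir_act (vir_act v j) i - vir_act (vir_act v i) j =
    mul_lam_sub_mu (subst_add (vir_act v)) i j
}.

Record is_submodule (F : numFieldType) (V : virModule F) (W : set V) : Prop :=
  IsSubmodule {
    submodule0 : W 0;
    submoduleD : forall u v, W u -> W v -> W (u + v);
    submoduleZ : forall (p : {poly F}) v, W v -> W (p *: v);
    submoduleL : forall v k, W v -> W (vir_act v k)
  }.

Definition irreducible (F : numFieldType) (V : virModule F) : Prop :=
  (exists v : V, v <> 0) /\
  forall W : set V, is_submodule W -> W = [set 0]%classic \/ W = [set: V]%classic.

Section Vabc.
Variables (F : numFieldType) (n : nat).
Variables (a b : F) (c : 'M[{poly F}]_n).
Local Notation V := 'cV[{poly F}]_n.

Definition scrL (f : V) : V := map_mx (@deriv F) f + c *m f.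

(* For k = 0 the second summand vanishes, whatever the exponent k.-1. *)
Definition Vabc_act (f : V) (k : nat) : V :=
  ((k`!%:R)^-1)%:P *: (('X + b%:P) *: iter k scrL f
                       + (k%:R * a)%:P *: iter k.-1 scrL f).

Lemma scrL_linear (d : F) (f g : V) :
  scrL (d%:P *: f + g) = d%:P *: scrL f + scrL g.
Proof.
rewrite /scrL mulmxDr -scalemxAr scalerDr addrACA; congr (_ + _).
by apply/matrixP => i j; rewrite !mxE derivD derivM derivC mul0r add0r.
Qed.

Lemma scrLX (f : V) : scrL ('X *: f) = 'X *: scrL f + f.
Proof.
rewrite /scrL -scalemxAr scalerDr addrAC; congr (_ + _).
by apply/matrixP => i j; rewrite !mxE derivM derivX mul1r addrC.
Qed.

Lemma iter_linear k (d : F) (f g : V) :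
  iter k scrL (d%:P *: f + g) = d%:P *: iter k scrL f + iter k scrL g.
Proof. by elim: k => //= k ->; rewrite scrL_linear. Qed.

Lemma iter_scrL0 k : iter k scrL 0 = 0.
Proof.
have := iter_linear k (-1) 0 0.
by rewrite scaler0 addr0 polyCN scaleN1r addNr.
Qed.

Lemma iter_scale k (d : F) (f : V) :
  iter k scrL (d%:P *: f) = d%:P *: iter k scrL f.
Proof. by have := iter_linear k d f 0; rewrite !addr0 iter_scrL0 addr0. Qed.

Lemma iter_add k (f g : V) :
  iter k scrL (f + g) = iter k scrL f + iter k scrL g.
Proof. by have := iter_linear k 1 f g; rewrite !scale1r. Qed.

Lemma iterX k (f : V) :
  iter k scrL ('X *: f) = 'X *: iter k scrL f + k%:R%:P *: iter k.-1 scrL f.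
Proof.
elim: k => [|k IH] /=; first by rewrite scale0r addr0.
rewrite IH addrC scrL_linear scrLX addrCA; congr (_ + _).
have -> : k%:R%:P *: scrL (iter k.-1 scrL f) = k%:R%:P *: iter k scrL f.
  by case: k {IH} => [|k] //=; rewrite !scale0r.
by rewrite -[X in _ + X]scale1r -scalerDl -polyCD natr1.
Qed.

Lemma iterXb k (f : V) :
  iter k scrL (('X + b%:P) *: f) =
  ('X + b%:P) *: iter k scrL f + k%:R%:P *: iter k.-1 scrL f.
Proof. by rewrite !scalerDl iter_add iterX iter_scale addrAC. Qed.

Lemma Vabc_act_linear (d : F) (u v : V) k :
  Vabc_act (d%:P *: u + v) k = d%:P *: Vabc_act u k + Vabc_act v k.
Proof.
rewrite /Vabc_act !iter_linear !scalerDr !scalerA.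
rewrite addrACA; congr (_ + _ + (_ + _)); congr (_ *: _); ring.
Qed.

Lemma Vabc_act_partial (v : V) k :
  Vabc_act ('X *: v) k = 'X *: Vabc_act v k + mul_lam (Vabc_act v) k.
Proof.
case: k => [|k]; rewrite /Vabc_act /mul_lam.
  by rewrite /= !mul0r !scale0r !addr0 !scalerA; congr (_ *: _); ring.
rewrite !iterX [k.+1.-1]/=.
move: (iter k.+1 scrL v) (iter k scrL v) (iter k.-1 scrL v) => u1 u2 u3.
rewrite !scalerDr !scalerA -!addrA; congr (_ + _).
  by congr (_ *: _); ring.
rewrite addrCA; congr (_ + _); first by congr (_ *: _); ring.
have kn : (k.+1%:R : F) != 0 by rewrite pnatr_eq0.
have kf : (k`!%:R : F) != 0 by rewrite pnatr_eq0 -lt0n fact_gt0.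
have e : (k.+1`!%:R^-1 * k.+1%:R : F) = k`!%:R^-1.
  by rewrite factS natrM invfM mulrAC mulVf // mul1r.
congr (_ + _); congr (_ *: _).
  by rewrite -e polyCM; ring.
by rewrite /= -e !polyCM; ring.
Qed.

Let w f m := iter m scrL f.

Lemma Vabc_act_comp (v : V) i j :
  Vabc_act (Vabc_act v j) i =
  (i`!%:R^-1 * j`!%:R^-1)%:P *:
   (('X + b%:P) ^+ 2 *: w v (i + j)
   + (i%:R%:P + (i%:R + j%:R)%:P * a%:P) * ('X + b%:P) *: w v (i + j).-1
   + (i%:R * (i%:R - 1) * a + i%:R * j%:R * a ^+ 2)%:P *: w v (i + j).-2).
Proof.
rewrite /Vabc_act !iter_scale !iter_add !iterXb !iter_scale -!iterD -!/(w _ _).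
have e1 : i%:R%:P *: w v (i.-1 + j)%N = i%:R%:P *: w v (i + j).-1.
  by case: i => [|i] //=; rewrite !scale0r.
have e2 : j%:R%:P *: w v (i + j.-1)%N = j%:R%:P *: w v (i + j).-1.
  by case: (j) => [|j'] /=; rewrite ?scale0r // addnS.
have e3 : (i%:R * i.-1%:R)%:P *: w v (i.-1.-1 + j)%N
        = (i%:R * (i%:R - 1))%:P *: w v (i + j).-2.
  case: (i) => [|[|i']] /=; rewrite ?(mul0r, mulr0, subrr, scale0r) //.
  by rewrite -[i'.+2%:R]natr1 addrK.
have e4 : (i%:R * j%:R)%:P *: w v (i.-1 + j.-1)%N
        = (i%:R * j%:R)%:P *: w v (i + j).-2.
  case: (i) => [|i']; first by rewrite mul0r !scale0r.
  case: (j) => [|j']; first by rewrite mulr0 !scale0r.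
  by rewrite addnS.
transitivity ((i`!%:R^-1 * j`!%:R^-1)%:P *:
  (('X + b%:P) ^+ 2 *: w v (i + j)
   + (('X + b%:P) *: (i%:R%:P *: w v (i.-1 + j)%N)
      + ('X + b%:P) * a%:P *: (j%:R%:P *: w v (i + j.-1)%N)
      + ('X + b%:P) * a%:P *: (i%:R%:P *: w v (i.-1 + j)%N))
   + (a%:P *: ((i%:R * i.-1%:R)%:P *: w v (i.-1.-1 + j)%N)
      + (a ^+ 2)%:P *: ((i%:R * j%:R)%:P *: w v (i.-1 + j.-1)%N)))).
  move: (w v _) (w v _) (w v _) (w v _) (w v _) => u1 u2 u3 u4 u5.
  rewrite !scalerDr !scalerA -!addrA.
  (congr (_ + _); first by congr (_ *: _); ring).
  (congr (_ + _); first by congr (_ *: _); ring).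
  (congr (_ + _); first by congr (_ *: _); ring).
  (congr (_ + _); first by congr (_ *: _); ring).
  by (congr (_ + _)); congr (_ *: _); ring.
rewrite e1 e2 e3 e4; congr (_ *: (_ + _ + _)).
  by rewrite !scalerA -!scalerDl; congr (_ *: _); rewrite polyCD; ring.
by rewrite !scalerA -!scalerDl; congr (_ *: _); ring.
Qed.

Lemma Vabc_act_bracket (v : V) i j :
  Vabc_act (Vabc_act v j) i - Vabc_act (Vabc_act v i) j =
  mul_lam_sub_mu (subst_add (Vabc_act v)) i j.
Proof.
have nf m : (m`!%:R : F) != 0 by rewrite pnatr_eq0 -lt0n fact_gt0.
have binE p q : ('C(p + q, p)%:R : F) = (p + q)`!%:R * p`!%:R^-1 * q`!%:R^-1.
  apply: (mulIf (nf q)); rewrite mulfVK //; apply: (mulIf (nf p)).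
  rewrite mulfVK // -!natrM -mulnA [(q`! * _)%N]mulnC.
  by rewrite -{2}(addKn p q) bin_fact // leq_addr.
transitivity (((i%:R - j%:R) * i`!%:R^-1 * j`!%:R^-1 * (i + j).-1`!%:R)%:P *:
   Vabc_act v (i + j).-1).
  transitivity ((i`!%:R^-1 * j`!%:R^-1)%:P *: ((i%:R - j%:R)%:P *:
    (('X + b%:P) *: w v (i + j).-1
     + ((i%:R + j%:R - 1) * a)%:P *: w v (i + j).-2))).
    rewrite !Vabc_act_comp [(j + i)%N]addnC [j`!%:R^-1 * _]mulrC -scalerBr.
    move: (w v _) (w v _) (w v _) => u0 u1 u2; congr (_ *: _).
    rewrite !opprD addrACA [X in X + _]addrACA subrr add0r -!scalerBl.
    by rewrite scalerDr !scalerA; congr (_ *: _ + _ *: _); ring.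
  rewrite scalerA -polyCM /Vabc_act -!/(w _ _) -natrD.
  case Em: (i + j)%N => [|m].
    move/eqP: Em; rewrite addn_eq0 => /andP[/eqP-> /eqP->].
    by rewrite subrr !(mul0r, mulr0) !scale0r.
  rewrite [m.+1.-1]/= [m.+1.-2]/= -natr1 addrK.
  move: (w v _) (w v _) => u1 u2.
  rewrite [in RHS]scalerA -polyCM mulfK //; congr (_ %:P *: _); ring.
rewrite /mul_lam_sub_mu /subst_add.
have fS p : (p`!%:R^-1 : F) = p.+1`!%:R^-1 * p.+1%:R.
  by rewrite factS natrM invfM mulrAC mulVf ?pnatr_eq0 // mul1r.
have H p q : Vabc_act v (p + q)%N *+ 'C(p + q, p) =
    ((p + q)`!%:R * p`!%:R^-1 * q`!%:R^-1)%:P *: Vabc_act v (p + q)%N.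
  by rewrite -binE polyC_natr scaler_nat.
move: (Vabc_act v) H => T H.
case: i => [|i]; case: j => [|j]; rewrite ?H.
- by rewrite subrr !mul0r scale0r subr0.
- rewrite add0n !sub0r -scaleNr -polyCN [j.+1.-1]/= add0n.
  by congr (_ %:P *: _); rewrite [j`!%:R^-1]fS; ring.
- rewrite addn0 !subr0 [i.+1.-1]/= addn0.
  by congr (_ %:P *: _); rewrite [i`!%:R^-1]fS; ring.
rewrite !addnS !addSn [_.+2.-1]/= -scalerBl -polyCB.
by congr (_ %:P *: _); rewrite [i`!%:R^-1]fS [j`!%:R^-1]fS; ring.
Qed.

Definition Vabc : virModule F :=
  VirModule Vabc_act_linear Vabc_act_partial Vabc_act_bracket.

End Vabc.

(* Main.v *)
(** With [𝓛 = d/dx + C(x)], the module [V_{a,b,C}] is irreducible iff the only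
    [v] in [C[x]^2] with [det (v, 𝓛 v) = 0] is [0].  If [v <> 0] and
    [det (v, 𝓛 v) = 0], the vectors collinear to [v] form a proper submodule.
    Conversely, a nonzero submodule [W] contains the [𝓛]-orbit of some [v <> 0]:
    for [a <> 1], [W] is itself stable under [𝓛], and for [a = 1] the action is
    [e^{λ𝓛} (x + b)], so that [(x + b) W] works.  The vectors whose [𝓛]-orbit lies
    in [W] form an [𝓛]-stable [C[x]]-module, and by Cramer's rule it contains
    [p V] with [p = det (v, 𝓛 v) <> 0]; being [𝓛]-stable, it contains [p' V],
    [p'' V], etc., hence [V].  Finally, [det (v, 𝓛 v) = 0] is the homogeneous form
    of the Riccati equation for [γ = v_1 / v_2]. *)
Require Import Defs.
From mathcomp Require Import all_boot all_order all_algebra.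
From mathcomp Require Import fraction reals complex.
From mathcomp Require Import ring classical_sets boolp.

Import Order.TTheory GRing.Theory Num.Theory.
Local Open Scope ring_scope.

Lemma scrLZ (F : numFieldType) (n : nat) (c : 'M[{poly F}]_n) p f :
  scrL c (p *: f) = p^`() *: f + p *: scrL c f.
Proof.
rewrite /scrL -scalemxAr scalerDr addrA; congr (_ + _).
by apply/matrixP => i j; rewrite !mxE derivM.
Qed.

(** In characteristic 0 the leading coefficient is only multiplied by the degree, a nonzero
    scalar. *)
Lemma deriv_neq0 (F : numFieldType) (p : {poly F}) :
  (1 < size p)%N -> p^`() != 0.
Proof.
move=> p1; apply/eqP => /(congr1 (fun q : {poly F} => q`_(size p).-2)) /eqP.
rewrite coef_deriv coef0 -mulr_natr mulf_eq0 pnatr_eq0 orbF.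
have -> : (size p).-2.+1 = (size p).-1 by case: (size p) p1 => [|[|m]].
by rewrite -lead_coefE lead_coef_eq0 -size_poly_eq0; case: (size p) p1.
Qed.

Lemma lift0_ord_max : lift ord0 ord0 = ord_max :> 'I_2.
Proof. exact: val_inj. Qed.

(** * The determinant pairing on columns of height 2 *)

Section TwoByTwo.
Context {F : numFieldType}.
Implicit Types (c : 'M[{poly F}]_2) (u v f : 'cV[{poly F}]_2).

Lemma colP2 u v : u ord0 ord0 = v ord0 ord0 ->
  u ord_max ord0 = v ord_max ord0 -> u = v.
Proof.
move=> e0 e1; apply/colP => i.
by case: (unliftP ord0 i) => [j|] -> //; rewrite (ord1 j) lift0_ord_max.
Qed.

Lemma scrLE c f i : scrL c f i ord0 =
  (f i ord0)^`() + (c i ord0 * f ord0 ord0 + c i ord_max * f ord_max ord0).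
Proof. by rewrite !mxE !big_ord_recl big_ord0 addr0 lift0_ord_max. Qed.

Definition det2 u v : {poly F} :=
  u ord0 ord0 * v ord_max ord0 - u ord_max ord0 * v ord0 ord0.

Lemma cramer2 u v f : det2 u v *: f = det2 f v *: u + det2 u f *: v.
Proof. by apply: colP2; rewrite /det2 !mxE; ring. Qed.

(** Pairing with the two basis vectors reads off the coordinates of [v] up to sign. Hence the kernel
    of [det2 v] is proper when [v] is nonzero. *)
Lemma det2_orth_eq0 v : (forall f, det2 v f = 0) -> v = 0.
Proof.
move=> v0; apply: colP2; rewrite mxE.
  have := v0 (\col_i (i == ord_max)%:R).
  by rewrite /det2 !mxE /= mulr1 mulr0 subr0.
have := v0 (\col_i (i == ord0)%:R).
by rewrite /det2 !mxE /= mulr1 mulr0 sub0r => /eqP; rewrite oppr_eq0 => /eqP.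
Qed.

(** Over the field of fractions [f] is a multiple of [v], so [scrL c f] is a combination of [v] and
    [scrL c v], both collinear to [v]. The proof avoids fractions by using the relation [E] and its
    derivative [E']. *)
Lemma det2_scrL c v f : v != 0 -> det2 v (scrL c v) = 0 ->
  det2 v f = 0 -> det2 v (scrL c f) = 0.
Proof.
move=> v0; rewrite /det2 !scrLE.
set p := v ord0 ord0; set q := v ord_max ord0.
set f0 := f ord0 ord0; set f1 := f ord_max ord0.
set c11 := c ord0 ord0; set c12 := c ord0 ord_max.
set c21 := c ord_max ord0; set c22 := c ord_max ord_max.
move=> D0 /eqP; rewrite subr_eq0 => /eqP E.
have E' : p^`() * f1 + p * f1^`() = q^`() * f0 + q * f0^`().
  by rewrite -!derivM E.
have [p0|p0] := eqVneq p 0; first last.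
  (* Modulo [E] and [E'], [p] times the goal's determinant is [f0] times [det2 v (scrL c v)]. *)
  apply/eqP; rewrite -(mulrI_eq0 _ (mulfI p0)); apply/eqP.
  transitivity (p * (p^`() * f1 + p * f1^`()) - (p * f1) * p^`()
    - p * q * f0^`() + p * p * c21 * f0 + (p * f1) * p * c22
    - p * q * c11 * f0 - (p * f1) * q * c12); first by ring.
  rewrite E' E; transitivity (f0 *
   (p * (q^`() + (c21 * p + c22 * q)) - q * (p^`() + (c11 * p + c12 * q)))).
    by ring.
  by rewrite D0 mulr0.
(* Now [p = 0], so [q] is the coordinate to multiply by, and the factor becomes [f1]. *)
have q0 : q != 0.
  by apply: contraNneq v0 => q0; apply/eqP/colP2; rewrite mxE.
apply/eqP; rewrite -(mulrI_eq0 _ (mulfI q0)); apply/eqP.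
transitivity (p * q * f1^`() - q * (q^`() * f0 + q * f0^`())
    + (q * f0) * q^`() + (q * f0) * p * c21 + p * q * c22 * f1
    - (q * f0) * q * c11 - q * q * c12 * f1); first by ring.
rewrite -E' -E; transitivity (f1 *
 (p * (q^`() + (c21 * p + c22 * q)) - q * (p^`() + (c11 * p + c12 * q)))).
  by ring.
by rewrite D0 mulr0.
Qed.

End TwoByTwo.

(** * Polynomial submodules and stability under 𝓛 *)

Section Stable.
Context {F : numFieldType} {n : nat} (c : 'M[{poly F}]_n).
Variable W : set 'cV[{poly F}]_n.
Hypothesis WD : forall u v, W u -> W v -> W (u + v).
Hypothesis WZ : forall p v, W v -> W (p *: v).

(** By the Leibniz rule, [scrL c (p *: f)] is a sum of two multiples, of [f] and of [scrL c f]. Both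
    vectors have their orbits in [W], so the induction runs over all [p] and [f] at once. *)
Lemma scrL_core_scale p f :
  (forall k, W (iter k (scrL c) f)) -> forall k, W (iter k (scrL c) (p *: f)).
Proof.
move=> Wf k; elim: k p f Wf => [|k IH] p f Wf; first exact/WZ/(Wf 0).
rewrite iterSr scrLZ iter_add; apply: WD; apply: IH => // m.
by rewrite -iterSr; apply: Wf.
Qed.

Hypothesis WL : forall v, W v -> W (scrL c v).

Lemma scrL_stable_full (p : {poly F}) :
  p != 0 -> (forall f, W (p *: f)) -> forall f, W f.
Proof.
elim: {p}_.+1 {-2}p (ltnSn (size p)) => // m IH p pm p0 Wp.
have [p1|p1] := leqP (size p) 1.
  move=> f; have pE := size1_polyC p1.
  have q0 : p`_0 != 0 by rewrite -polyC_eq0 -pE.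
  have := WZ ((p`_0)^-1)%:P _ (Wp f).
  by rewrite {2}pE scalerA -polyCM mulVf // scale1r.
apply: (IH p^`()); last 2 first.
- exact: deriv_neq0.
- move=> f; have := WD _ _ (WL _ (Wp f)) (WZ (-1) _ (Wp (scrL c f))).
  by rewrite scrLZ scaleN1r addrK.
exact: leq_trans (lt_size_deriv p0) pm.
Qed.

End Stable.

(** * From the conformal action to the operator 𝓛 *)

Section Submodules.
Context {F : numFieldType} {n : nat} {a b : F} {c : 'M[{poly F}]_n}.

Lemma scrL_stable_submodule (W : set 'cV[{poly F}]_n) :
  W 0 -> (forall u v, W u -> W v -> W (u + v)) ->
  (forall p v, W v -> W (p *: v)) -> (forall v, W v -> W (scrL c v)) ->
  is_submodule (V := Vabc a b c) W.
Proof.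
move=> W0 WD WZ WL; split => // v k Wv.
have Wk m : W (iter m (scrL c) v) by elim: m => //= m; apply: WL.
by apply/WZ/WD; apply/WZ.
Qed.

Context {W : set 'cV[{poly F}]_n} (Wsub : is_submodule (V := Vabc a b c) W).
Let WD := submoduleD Wsub.
Let WZ := submoduleZ Wsub.

Lemma submodule_act f k : W f ->
  W (('X + b%:P) *: iter k (scrL c) f + (k%:R * a)%:P *: iter k.-1 (scrL c) f).
Proof.
move=> Wf; have := WZ k`!%:R%:P _ (submoduleL Wsub k Wf).
by rewrite /= scalerA -polyCM divff ?scale1r // pnatr_eq0 -lt0n fact_gt0.
Qed.

Lemma submoduleB u v : W u -> W v -> W (u - v).
Proof. by move=> Wu Wv; rewrite -scaleN1r; apply: WD (WZ _ _ _). Qed.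

(* [3! (x + b) L_3 f - 2! (x + b) 𝓛 L_2 f = (a - 1) (x + b) 𝓛^2 f] lies in [W];
   by [L_2], so does [2 a 𝓛 f]. *)
Lemma submodule_scrL f : a != 0 -> a != 1 -> W f -> W (scrL c f).
Proof.
move=> a0 a1 Wf; set y := 'X + b%:P.
have W1 g : W g -> W (y *: scrL c g).
  move=> Wg.
  have := submoduleB _ _ (submodule_act _ 1 Wg) (WZ (1%:R * a)%:P _ Wg).
  by rewrite addrK.
have W2 := submodule_act _ 2 Wf; have W3 := submodule_act _ 3 Wf.
have dy : y^`() = 1 by rewrite derivD derivX derivC addr0.
move: W2 (W1 _ W2) W3; rewrite /= -/y [y *: scrL c (scrL c f) + _]addrC.
rewrite scrL_linear scrLZ dy scale1r.
move: (scrL c f) => u1; move: (scrL c u1) => u2; move: (scrL c u2) => u3.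
move=> W2 W12 W3.
have Wu2 : W ((1 - a)%:P *: (y *: u2)).
  have := submoduleB _ _ W12 (WZ y _ W3).
  by congr W; apply/colP => i; rewrite !mxE; ring.
have a1' : 1 - a != 0 by rewrite subr_eq0 eq_sym.
have a2 : 2%:R * a != 0 by rewrite mulf_neq0 // pnatr_eq0.
have {Wu2} := WZ (1 - a)^-1%:P _ Wu2.
rewrite scalerA -polyCM mulVf // scale1r => Wu2.
have := WZ (2%:R * a)^-1%:P _ (submoduleB _ _ W2 Wu2).
by rewrite addrK scalerA -polyCM mulVf // scale1r.
Qed.

Lemma submodule_scrL_orbit : a != 0 -> (exists2 f, W f & f != 0) ->
  exists2 f, (forall k, W (iter k (scrL c) f)) & f != 0.
Proof.
move=> a0 [f Wf f0]; have [a1|a1] := eqVneq a 1; last first.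
  by exists f => //; elim=> //= k; apply: submodule_scrL.
exists (('X + b%:P) *: f).
  (* At [a = 1], [k!] times the coefficient of λ^k is exactly 𝓛^k applied to [('X + b%:P) *: f]. *)
  by move=> k; rewrite iterXb; have := submodule_act _ k Wf; rewrite a1 mulr1.
have y0 : 'X + b%:P != 0 :> {poly F}.
  by rewrite -size_poly_eq0 size_XaddC.
apply: contraNneq f0 => yf0; apply/eqP/colP => i; rewrite mxE.
have /eqP := congr1 (fun u : 'cV_n => u i ord0) yf0.
by rewrite !mxE mulf_eq0 (negPf y0) => /eqP.
Qed.

End Submodules.

Lemma irreducible_det2 (F : numFieldType) (a b : F) (c : 'M[{poly F}]_2) :
  a != 0 ->
  irreducible (Vabc a b c) <->
  forall v : 'cV[{poly F}]_2, det2 v (scrL c v) = 0 -> v = 0.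
Proof.
move=> a0; split=> [[_ irr] v Dv|noline].
  apply: contrapT => /eqP v0.
  have /irr[] : is_submodule (V := Vabc a b c) (fun f => det2 v f = 0).
  - apply: scrL_stable_submodule => [|u w|p u|u].
    + by rewrite /det2 !mxE !mulr0 subr0.
    + move=> u0 w0; rewrite -[RHS]addr0 -{1}u0 -w0 /det2 !mxE; ring.
    + by move=> u0; rewrite -(mulr0 p) -u0 /det2 !mxE; ring.
    + exact: det2_scrL.
  - move=> /(congr1 (@^~ v)) e; apply/negP: v0; rewrite negbK; apply/eqP.
    by have : [set 0 : 'cV[{poly F}]_2]%classic v by rewrite -e /det2; ring.
  - move=> e; apply/negP: v0; rewrite negbK; apply/eqP/det2_orth_eq0 => f.
    by have : [set: 'cV[{poly F}]_2]%classic f by []; rewrite -e.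
split.
  exists (const_mx 1 : 'cV[{poly F}]_2).
  move=> /(congr1 (fun u : 'cV_2 => u ord0 ord0)).
  by rewrite !mxE => /eqP; rewrite oner_eq0.
move=> W Wsub; have [nz|nz] := pselect (exists2 f, W f & f != 0); last first.
  left; apply/seteqP; split=> [f Wf|f ->]; last exact: submodule0 Wsub.
  by apply: contrapT => /eqP f0; apply: nz; exists f.
right; apply/seteqP; split=> // f _.
have [v Wv v0] := submodule_scrL_orbit Wsub a0 nz.
have Dv : det2 v (scrL c v) != 0.
  by apply: contraNneq v0 => Dv; apply/eqP/noline.
(* [W'] is the largest 𝓛-stable submodule inside [W]. *)
pose W' : set 'cV[{poly F}]_2 := fun g => forall k, W (iter k (scrL c) g).
have W'D u w : W' u -> W' w -> W' (u + w).
  by move=> Wu Ww k; rewrite iter_add; apply: (submoduleD Wsub).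
have W'Z p u : W' u -> W' (p *: u).
  exact: scrL_core_scale (submoduleD Wsub) (submoduleZ Wsub) _ _.
have W'L u : W' u -> W' (scrL c u) by move=> Wu k; rewrite -iterSr; apply: Wu.
(* The last argument [0] selects the zeroth iterate, turning [W' f] into [W f]. *)
apply: (scrL_stable_full c W' W'D W'Z W'L _ Dv _ f 0) => g.
by rewrite cramer2; apply: W'D; apply: W'Z => //; apply: W'L.
Qed.

(* The Riccati expression at [γ = v_1 / v_2] is [- det (v, 𝓛 v) / v_2 ^ 2]. *)
Lemma riccati_det2 (F : numFieldType) (c : 'M[{poly F}]_2)
    (v : 'cV[{poly F}]_2) (c11 := c ord0 ord0) (c12 := c ord0 ord_max)
    (c21 := c ord_max ord0) (c22 := c ord_max ord_max)
    (g := FracField.tofrac (v ord0 ord0) / FracField.tofrac (v ord_max ord0)) :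
  v ord_max ord0 != 0 ->
  (fracderiv g + FracField.tofrac (c11 - c22) * g
   - FracField.tofrac c21 * g ^+ 2 + FracField.tofrac c12 == 0) =
  (det2 v (scrL c v) == 0).
Proof.
rewrite /det2 !scrLE /g -/c11 -/c12 -/c21 -/c22.
set p := v ord0 ord0; set q := v ord_max ord0 => q0.
have q0' : FracField.tofrac q != 0 by rewrite tofrac_eq0.
rewrite fracderivE // -[RHS]tofrac_eq0.
transitivity (- FracField.tofrac
  (p * (q^`() + (c21 * p + c22 * q)) - q * (p^`() + (c11 * p + c12 * q)))
  / FracField.tofrac q ^+ 2 == 0); last first.
  by rewrite mulf_eq0 oppr_eq0 invr_eq0 expf_eq0 (negPf q0') orbF.
congr (_ == 0).
rewrite !(tofracXn, tofracD, tofracN, tofracB, tofracM).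
(* The derivatives enter as independent elements [x'] and [y'], which leaves a plain field
   identity. *)
have riccati (K : fieldType) (x y x' y' k11 k12 k21 k22 : K) : y != 0 ->
    (x' * y - x * y') / y ^+ 2 + (k11 - k22) * (x / y) - k21 * (x / y) ^+ 2
      + k12 =
    - (x * (y' + (k21 * x + k22 * y)) - y * (x' + (k11 * x + k12 * y)))
      / y ^+ 2 by move=> y0; field.
exact: riccati.
Qed.

Theorem theorem4p20 (R : realType) (a b : R[i]) (c : 'M[{poly R[i]}]_2)
    (c11 := c ord0 ord0) (c12 := c ord0 ord_max)
    (c21 := c ord_max ord0) (c22 := c ord_max ord_max) :
  a != 0 ->
  irreducible (Vabc a b c) <->
  [/\ c21 != 0, c12 != 0 &
    ~ exists g : {fraction {poly R[i]}},
        fracderiv g + FracField.tofrac (c11 - c22) * g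
        - FracField.tofrac c21 * g ^+ 2 + FracField.tofrac c12 = 0].
Proof.
move=> a0; rewrite irreducible_det2 //; split=> [noline|[c21_0 _ nosol] v Dv].
  have no_col (f : 'I_2 -> {poly R[i]}) i :
      f i != 0 -> det2 (\col_i f i) (scrL c (\col_i f i)) != 0.
    move=> fi0; apply: contraNneq fi0 => /noline.
    by move=> /(congr1 (fun u : 'cV_2 => u i ord0)); rewrite !mxE => ->.
  split.
  (* For the first basis vector the determinant is [c21]; for the second, below, it is [- c12]. *)
  - have := no_col (fun i => (i == ord0)%:R) ord0 (oner_neq0 _).
    apply: contraNneq => c0.
    rewrite /det2 !scrLE -/c21 c0 !mxE /= deriv0.
    by rewrite !(mul0r, mulr0, addr0, subr0) eqxx.
  - have := no_col (fun i => (i == ord_max)%:R) ord_max (oner_neq0 _).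
    apply: contraNneq => c0.
    rewrite /det2 !scrLE -/c12 c0 !mxE /= deriv0.
    by rewrite !(mul0r, mulr0, addr0, subr0) eqxx.
  - case=> g; have d0 := denom_ratioP (repr g).
    rewrite (frac_reprE g); move: (\n_(repr g)) (\d_(repr g)) d0 => n d d0.
    (* A solution [n / d] yields the column [(n, d)], nonzero because [d] is. *)
    pose f (i : 'I_2) := if i == ord0 then n else d.
    have /negP Df := no_col f ord_max d0.
    by move=> /eqP e; apply: Df; rewrite -riccati_det2 ?mxE.
have [v1|v1] := eqVneq (v ord_max ord0) 0; last first.
  have := riccati_det2 _ c v v1.
  by rewrite Dv eqxx => /eqP sol; case: nosol; eexists; apply: sol.
(* With second coordinate 0, the determinant reduces to [c21] times the square of the first
   coordinate. *)
apply: colP2; rewrite !mxE //; apply/eqP; move/eqP: Dv.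
rewrite /det2 !scrLE v1 deriv0 mul0r subr0 mulr0 addr0 add0r -/c21 mulrCA.
by rewrite mulf_eq0 (negPf c21_0) mulf_eq0 orbb.
Qed.
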